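(* Let $X=\bigcap_{i=1}^mX_i\subseteq\mathbb{R}^n$ with each $X_i$ closed convex and $X$ nonempty, and suppose there is $D_X>0$ with $\|u-v\|^2\le D_X^2$ for all $u,v\in X$. Let $F(x)=\mathbb{E}[F(x,\omega)]$ and assume: (A1) $F$ is $L$-Lipschitz continuous and monotone on $\mathbb{R}^n$; (A2) the solution set $X^*$ of VI$(X,F)$ is nonempty and compact and $\|F(x^* )\|\le C$ for all $x^*\in X^*$; (A4) the noise condition in the context holds with constants $\nu_1,\nu_2\ge0$; (A5) there is $\eta>0$ with $\|x-\Pi_X(x)\|^2\le\eta\max_i\|x-\Pi_{X_i}(x)\|^2$ for all $x\in\mathbb{R}^n$; (A6) $\inf_{k\ge0}P(l_k=i\mid\mathcal{F}_k)\ge\rho_i/m$ a.s. for each $i$, with $\rho_i\in(0,1]$; let $\rho=\min_i\rho_i$. Let $\{x_k\}$ be generated by (r-SPRG): $x_{k+1}=\Pi_{l_k}(x_k-\gamma_kF(2x_k-x_{k-1},\omega_k))$. Let $\beta\triangleq1-\frac{\rho}{32m\eta}$. Then: (a) if $\sum_k\gamma_k=\infty$ and $\sum_k\gamma_k^2<\infty$, then $\mathrm{dist}(x_k,X)\to0$ almost surely; (b) if $\gamma_k=1/k^{t/2}$ with $t\ge1$, then $\mathbb{E}[\mathrm{dist}(x_k,X)]\le\mathcal{O}(1/k^{t/2})$ for all $k\ge\bar k$, where $\bar k\triangleq\left\lceil\frac{1}{1-(1-\beta/2)^{1/t}}-1\right\rceil$; (c) if $\gamma_k=1/k^{1/2}$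 and $\bar x_{K,\bar k}\triangleq\frac{\sum_{k=\bar k+\lfloor K/2\rfloor}^{\bar k+K}\gamma_kx_k}{\sum_{k=\bar k+\lfloor K/2\rfloor}^{\bar k+K}\gamma_k}$ (with $\bar k$ as in (b) for $t=1$), then $\mathbb{E}[\mathrm{dist}(\bar x_{K,\bar k},X)]\le\mathcal{O}(1/\sqrt K)$.
   Context: VI$(X,F)$: find $x^*\in X$ with $F(x^* )^T(x-x^* )\ge0$ for all $x\in X$. $\Pi_{l_k}$ is Euclidean projection onto $X_{l_k}$, $l_k$ a random index; $\mathrm{dist}(x,X)=\min_{y\in X}\|x-y\|$. The scheme uses initial points $x_{-1},x_0$. $\mathcal{F}_k$ is the history before iteration $k$'s random quantities. Noise condition (A4): with $y_k=2x_k-x_{k-1}$ and $w_k=F(y_k,\omega_k)-F(y_k)$, $\mathbb{E}[w_k\mid\mathcal{F}_k]=0$ and $\mathbb{E}[\|w_k\|^2\mid\mathcal{F}_k]\le\nu_1^2\|y_k\|^2+\nu_2^2$ a.s. *)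

(* Defs.v *)
From HB Require Import structures.
From mathcomp Require Import all_boot all_order all_algebra.
From mathcomp Require Import all_classical all_reals all_analysis measurable_realfun matrix_topology matrix_normedtype.
Set Implicit Arguments. Unset Strict Implicit. Unset Printing Implicit Defensive.
Import Order.TTheory GRing.Theory Num.Theory.
Import numFieldNormedType.Exports.
Local Open Scope classical_set_scope.
Local Open Scope ring_scope.

Section defs.
Variable R : realType.

Definition dotv (n : nat) (u v : 'rV[R]_n) : R := \sum_(j < n) u 0 j * v 0 j.
Definition enorm (n : nat) (v : 'rV[R]_n) : R := Num.sqrt (\sum_(j < n) v 0 j ^+ 2).

Definition dist (n : nat) (x : 'rV[R]_n) (A : set 'rV[R]_n) : R :=
  inf [set enorm (x - y) | y in A].

Definition is_proj (n : nat) (A : set 'rV[R]_n) (x p : 'rV[R]_n) : Prop :=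
  A p /\ forall y, A y -> enorm (x - p) <= enorm (x - y).

Definition VIsol (n : nat) (X : set 'rV[R]_n) (F : 'rV[R]_n -> 'rV[R]_n) : set 'rV[R]_n :=
  [set xs | X xs /\ forall y, X y -> 0 <= dotv (F xs) (y - xs)].

Section prob.
Context d (Omega : measurableType d) (P : probability Omega R).

Definition Gmeas (G : set (set Omega)) (f : Omega -> R) : Prop :=
  forall B : set R, measurable B -> G (f @^-1` B).
Definition Gmeas_e (G : set (set Omega)) (f : Omega -> \bar R) : Prop :=
  forall B : set (\bar R), measurable B -> G (f @^-1` B).

Definition cond_exp (G : set (set Omega)) (Y Z : Omega -> R) : Prop :=
  [/\ P.-integrable setT (EFin \o Y), Gmeas G Z, P.-integrable setT (EFin \o Z) &
      forall A, G A -> (\int[P]_(a in A) (Y a)%:E = \int[P]_(a in A) (Z a)%:E)%E].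

Definition cond_exp_nneg (G : set (set Omega)) (Y : Omega -> R) (Z : Omega -> \bar R) : Prop :=
  [/\ measurable_fun setT Y, (forall a, 0 <= Y a), Gmeas_e G Z, (forall a, (0 <= Z a)%E) &
      forall A, G A -> (\int[P]_(a in A) (Y a)%:E = \int[P]_(a in A) Z a)%E].
End prob.

Definition hist_filtration d (Omega : measurableType d) d' (Xi : measurableType d')
  (m : nat) (l : nat -> Omega -> 'I_m) (omega : nat -> Omega -> Xi) (k : nat)
  : set (set Omega) :=
  <<s [set A | exists2 j, (j < k)%N &
        (exists i, A = l j @^-1` [set i]) \/
        (exists2 B : set Xi, measurable B & A = omega j @^-1` B)] >>.

Definition xprev (T : Type) (n : nat) (xm1 : 'rV[R]_n) (x : nat -> T -> 'rV[R]_n)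
  (k : nat) (a : T) : 'rV[R]_n :=
  match k with 0 => xm1 | k'.+1 => x k' a end.

Definition kbar (beta t : R) : nat :=
  `| Num.ceil ((1 - (1 - beta / 2) `^ t^-1)^-1 - 1) |%N.

End defs.

(* Main.v *)
(* Everything is controlled by the squared distance D_k = dist(x_k, X)^2.
   Comparing x_{k+1} with the projection of x_k on X and using the Pythagoras
   inequality for the projection on X_{l_k},
     D_{k+1} + dist(x_k, X_{l_k})^2 / 2
       <= (1 + e) D_k + (2 + 1/e) gamma_k^2 |F(y_k, omega_k)|^2.
   By (A5) and (A6) the expectation of dist(x_k, X_{l_k})^2 is at least
   kappa E[D_k] with kappa = rho / (m eta), while Lipschitz continuity,
   boundedness of X and (A4) bound E|F(y_k, omega_k)|^2 affinely in E[D_k] and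
   E[D_{k-1}].  Taking e = kappa / 4 gives
     E[D_{k+1}] <= (1 - kappa/4) E[D_k] + gamma_k^2 (A + A E[D_k] + A E[D_{k-1}]).
   If gamma^2 is summable then so is E[D_k], hence D_k -> 0 almost surely; if
   gamma_k^2 decays polynomially then E[D_k] = O(gamma_k^2).  The bounds on
   E[dist] follow from 2 dist <= dist^2 / s + s, and (c) from convexity of
   dist^2. *)
Require Import Defs.
From HB Require Import structures.
From mathcomp Require Import all_boot all_order all_algebra.
From mathcomp Require Import all_classical all_reals all_analysis measurable_realfun matrix_topology matrix_normedtype.
From mathcomp Require Import ring lra.
Import Order.TTheory GRing.Theory Num.Theory.
Import numFieldNormedType.Exports.
Local Open Scope classical_set_scope.
Local Open Scope ring_scope.
Set Implicit Arguments.
Unset Strict Implicit.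

(** * Euclidean projections *)

Section euclidean.
Variables (R : realType) (n : nat).
Implicit Types (u v z p : 'rV[R]_n) (A : set 'rV[R]_n).

Definition sqn v : R := \sum_(j < n) v 0 j ^+ 2.

Lemma sqn_ge0 v : 0 <= sqn v.
Proof. by apply: sumr_ge0 => j _; exact: sqr_ge0. Qed.

Lemma enorm_ge0 v : 0 <= enorm v.
Proof. exact: sqrtr_ge0. Qed.

Lemma enorm_sqr v : enorm v ^+ 2 = sqn v.
Proof. by rewrite sqr_sqrtr // sqn_ge0. Qed.

Lemma sqnZ a v : sqn (a *: v) = a ^+ 2 * sqn v.
Proof. by rewrite /sqn mulr_sumr; apply: eq_bigr => j _; rewrite mxE exprMn. Qed.

Lemma sqnN v : sqn (- v) = sqn v.
Proof. by rewrite -scaleN1r sqnZ sqrrN expr1n mul1r. Qed.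

Lemma sqnB u v : sqn (u - v) = sqn u - 2 * dotv u v + sqn v.
Proof.
rewrite /sqn /dotv mulr_sumr -sumrB -big_split /=.
by apply: eq_bigr => j _; rewrite !mxE; ring.
Qed.

Lemma sqnC u v : sqn (u - v) = sqn (v - u).
Proof. by rewrite -sqnN opprB. Qed.

(** In each coordinate the gap is [e^-1] times a square. The free weight [e] keeps the coefficient
    of [sqn u] as close to 1 as desired. *)
Lemma sqnD_young e u v : 0 < e ->
  sqn (u + v) <= (1 + e) * sqn u + (1 + e^-1) * sqn v.
Proof.
move=> e0; rewrite /sqn !mulr_sumr -big_split /=.
apply: ler_sum => j _; rewrite mxE; move: (u 0 j) (v 0 j) => a b.
rewrite -subr_ge0; have e00 : e != 0 by rewrite gt_eqF.
have -> : (1 + e) * a ^+ 2 + (1 + e^-1) * b ^+ 2 - (a + b) ^+ 2 =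
          e^-1 * (e * a - b) ^+ 2 by field.
by rewrite mulr_ge0 ?sqr_ge0 // invr_ge0 ltW.
Qed.

Lemma sqnD_le u v : sqn (u + v) <= 2 * sqn u + 2 * sqn v.
Proof. by have := @sqnD_young 1 u v ltr01; rewrite invr1. Qed.

Lemma sqn_convex a u v : 0 <= a <= 1 ->
  sqn (a *: u + (1 - a) *: v) <= a * sqn u + (1 - a) * sqn v.
Proof.
move=> /andP[a0 a1]; rewrite /sqn !mulr_sumr -big_split /=.
apply: ler_sum => j _; rewrite !mxE -subr_ge0; move: (u 0 j) (v 0 j) => b c.
have -> : a * b ^+ 2 + (1 - a) * c ^+ 2 - (a * b + (1 - a) * c) ^+ 2 =
          a * (1 - a) * (b - c) ^+ 2 by ring.
by rewrite mulr_ge0 ?sqr_ge0 // mulr_ge0 // subr_ge0.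
Qed.

Lemma ler_enorm u v : (enorm u <= enorm v) = (sqn u <= sqn v).
Proof. by rewrite /enorm ler_sqrt // sqn_ge0. Qed.

Lemma convex_setP A u v a : convex_set A -> A u -> A v -> 0 <= a <= 1 ->
  A (a *: u + (1 - a) *: v).
Proof.
move=> cA Au Av /andP[a0 a1].
have := cA u v (Itv01 a0 a1); rewrite !inE; exact.
Qed.

Lemma proj_min A z p u : is_proj A z p -> A u -> sqn (z - p) <= sqn (z - u).
Proof. by move=> [_ pmin] Au; rewrite -ler_enorm; exact: pmin. Qed.

(** If [z - p] and [u - p] had a positive inner product, a short move from [p] towards [u] would
    stay in [A] and come closer to [z]. *)
Lemma proj_pythagoras A z p u : convex_set A -> is_proj A z p -> A u ->
  sqn (p - u) + sqn (z - p) <= sqn (z - u).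
Proof.
move=> cA pz Au; have Ap := pz.1.
have -> : z - u = (z - p) - (u - p) by rewrite opprB addrA subrK.
rewrite (sqnB (z - p)) (sqnC p).
suff : dotv (z - p) (u - p) <= 0 by lra.
rewrite leNgt; apply/negP => d0.
have s0 := sqn_ge0 (u - p).
set d := dotv _ _ in d0; set s := sqn (u - p) in s0.
(* This step length lies in [0, 1] and satisfies [a * s <= d], so the second-order cost [a ^+ 2 * s]
   stays below the first-order gain [2 * a * d]. *)
pose a := d / (d + s).
have ds : 0 < d + s by lra.
have a01 : 0 <= a <= 1.
  by rewrite divr_ge0 ?(ltW d0) ?(ltW ds) //= ler_pdivrMr // mul1r; lra.
have := proj_min pz (convex_setP cA Au Ap a01).
have -> : z - (a *: u + (1 - a) *: p) = (z - p) - a *: (u - p).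
  by apply/rowP => j; rewrite !mxE; ring.
rewrite (sqnB (z - p)) sqnZ -/s.
have -> : dotv (z - p) (a *: (u - p)) = a * d.
  by rewrite /d /dotv mulr_sumr; apply: eq_bigr => j _; rewrite !mxE; ring.
have a0 : 0 < a by rewrite divr_gt0.
have as_ : a * s <= d.
  by rewrite /a mulrAC ler_pdivrMr // ler_wpM2l ?(ltW d0) //; lra.
have : a * (a * s) <= a * d by rewrite ler_wpM2l // ltW.
have : 0 < a * d by rewrite mulr_gt0.
rewrite expr2; lra.
Qed.

Lemma dist_proj A z p : is_proj A z p -> dist z A = enorm (z - p).
Proof.
move=> [Ap pmin]; apply/eqP; rewrite eq_le; apply/andP; split.
  apply: ge_inf; last by exists p.
  by exists 0 => _ [y _ <-]; exact: enorm_ge0.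
by apply: lb_le_inf; [exists (enorm (z - p)), p | move=> _ [y Ay <-]; exact: pmin].
Qed.

(** Measured through the minimiser instead of an infimum; for a projection map it is the square of
    [dist]. *)
Definition sqdist (pr : 'rV[R]_n -> 'rV[R]_n) z : R := sqn (z - pr z).

Lemma sqdist_ge0 pr z : 0 <= sqdist pr z.
Proof. exact: sqn_ge0. Qed.

(** The convex combination of the two projections lies in [A], so it competes with the projection of
    the combined point. *)
Lemma sqdist_convex A pr a u v : convex_set A ->
  (forall z, is_proj A z (pr z)) -> 0 <= a <= 1 ->
  sqdist pr (a *: u + (1 - a) *: v) <= a * sqdist pr u + (1 - a) * sqdist pr v.
Proof.
move=> cA prP a01.
apply: le_trans (sqn_convex (u - pr u) (v - pr v) a01).
have := proj_min (prP (a *: u + (1 - a) *: v))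
  (convex_setP cA (prP u).1 (prP v).1 a01).
congr (_ <= sqn _); by apply/rowP => j; rewrite !mxE; ring.
Qed.

(** Jensen's inequality for normalised weights: the head of the list is split off with relative
    weight [a], and the rest is averaged by induction. *)
Lemma convex_average (h : 'rV[R]_n -> R) (w : nat -> R) (x : nat -> 'rV[R]_n) s :
  (forall a u v, 0 <= a <= 1 ->
    h (a *: u + (1 - a) *: v) <= a * h u + (1 - a) * h v) ->
  (forall k, 0 < w k) -> s != [::] ->
  h ((\sum_(k <- s) w k)^-1 *: \sum_(k <- s) w k *: x k) <=
  (\sum_(k <- s) w k)^-1 * \sum_(k <- s) w k * h (x k).
Proof.
move=> hconv w0; elim: s => // k s IH _.
rewrite !big_cons; have wk := w0 k; have wk0 : w k != 0 by rewrite gt_eqF.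
have [->|sn0] := eqVneq s [::].
  by rewrite !big_nil !addr0 scalerA mulrA !mulVf // scale1r mul1r.
set S := \sum_(i <- s) w i; have {IH} := IH sn0; rewrite -/S => IH.
have Spos : 0 < S.
  rewrite /S; case: s sn0 {IH S} => // i s _; rewrite big_cons ltr_wpDr //.
  by apply: sumr_ge0 => j _; exact: ltW.
have Sn0 : S != 0 by rewrite gt_eqF.
pose a := w k / (w k + S).
have ws0 : w k + S != 0 by rewrite gt_eqF // addr_gt0.
have wS := ltW (addr_gt0 wk Spos).
have a01 : 0 <= a <= 1.
  by rewrite divr_ge0 ?(ltW wk) //= ler_pdivrMr ?addr_gt0 // mul1r lerDl ltW.
have a1E : 1 - a = S / (w k + S) by rewrite /a; field.
have /(_ a01) := hconv a (x k) (S^-1 *: \sum_(j <- s) w j *: x j).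
have -> : a *: x k + (1 - a) *: (S^-1 *: \sum_(j <- s) w j *: x j) =
   (w k + S)^-1 *: (w k *: x k + \sum_(j <- s) w j *: x j).
  rewrite scalerDr !scalerA a1E; congr (_ *: _ + _ *: _); rewrite /a; first ring.
  by field; rewrite Sn0 ws0.
move=> /le_trans; apply.
rewrite mulrDr lerD //; first by rewrite mulrA /a (mulrC (w k)).
rewrite a1E; apply: le_trans (_ : S / (w k + S) * (S^-1 * \sum_(j <- s) w j * h (x j)) <= _).
  by rewrite ler_wpM2l // divr_ge0 // ltW.
by rewrite mulrA le_eqVlt; apply/orP; left; apply/eqP; congr (_ * _); field; rewrite Sn0 ws0.
Qed.

End euclidean.

(** * Contractive recursions with a delay *)

Section recursion.
Variable R : realType.
Implicit Types (V g : nat -> R).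

(** Summing the recursion from [N] on telescopes, so that [a] times the sum of [V] is paid for by
    [V N] and the sum of [g]. *)
Lemma contraction_summable V g a A N : 0 < a -> 0 <= A ->
  (forall k, 0 <= V k) -> (forall k, 0 <= g k) -> cvgn (series g) ->
  (forall k, (N <= k)%N -> V k.+1 <= (1 - a) * V k + A * g k) ->
  exists c, forall K, \sum_(0 <= k < K) V k <= c.
Proof.
move=> a0 A0 V0 g0 cg rec.
have [G GP] : exists G, forall K, \sum_(0 <= k < K) g k <= G.
  exists (limn (series g)) => K; apply: nondecreasing_cvgn_le => //.
  by apply/nondecreasing_seqP => k; rewrite seriesSr lerDl.
(* The last term [V (N + j)] is kept on the left so that the induction closes; it is dropped
   afterwards. *)
have bnd j : a * \sum_(N <= k < N + j) V k + V (N + j)%N <=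
             V N + A * \sum_(N <= k < N + j) g k.
  elim: j => [|j IH]; first by rewrite addn0 !big_geq // !mulr0; lra.
  rewrite addnS !big_nat_recr ?leq_addr //=.
  have := rec (N + j)%N (leq_addr _ _); lra.
exists (\sum_(0 <= k < N) V k + a^-1 * (V N + A * G)) => K.
apply: le_trans (_ : \sum_(0 <= k < N + K) V k <= _).
  by rewrite (@big_cat_nat _ _ _ K 0 (N + K)) ?leq_addl //= lerDl; apply: sumr_ge0.
rewrite (@big_cat_nat _ _ _ N 0 (N + K)) ?leq_addr //= lerD2l.
rewrite -ler_pdivrMl ?invr_gt0 // invrK.
apply: le_trans (_ : V N + A * \sum_(N <= k < N + K) g k <= _).
  by apply: le_trans (bnd K); rewrite lerDl.
rewrite lerD2l ler_wpM2l //; apply: le_trans (GP (N + K)%N).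
by rewrite (@big_cat_nat _ _ _ N 0 (N + K)) ?leq_addr //= lerDr; apply: sumr_ge0.
Qed.

(** Since [g] loses at most the factor [1 - a / 2] per step while [V] contracts by [1 - a], a slack
    of [a / 2] remains to absorb the forcing term [A * g k]. *)
Lemma contraction_rate V g a A N : 0 < a -> 0 <= A ->
  (forall k, 0 <= V k) -> (forall k, 0 < g k) ->
  (forall k, (N <= k)%N -> (1 - a / 2) * g k <= g k.+1) ->
  (forall k, (N <= k)%N -> V k.+1 <= (1 - a) * V k + A * g k) -> a <= 1 ->
  exists2 c, 0 <= c & forall k, V k <= c * g k.
Proof.
move=> a0 A0 V0 g0 slow rec a1.
have q0 k : 0 <= V k / g k by rewrite divr_ge0 // ltW.
(* The first summand gives [A <= c * (a / 2)] for the induction step; the sum of ratios covers the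
   finitely many indices up to [N]. *)
pose c := 2 * A / a + \sum_(0 <= k < N.+1) V k / g k.
have sum0 M : 0 <= \sum_(0 <= k < M) V k / g k by apply: sumr_ge0.
have A2 : 0 <= 2 * A / a by rewrite divr_ge0 ?mulr_ge0 // ltW.
have small k : (k <= N)%N -> V k <= c * g k.
  move=> kN; rewrite -ler_pdivrMr // /c (@big_cat_nat _ _ _ k) //=; last exact: leqW.
  rewrite (@big_cat_nat _ _ _ k.+1 k) //= big_nat1.
  have : 0 <= \sum_(k.+1 <= i < N.+1) V i / g i by apply: sumr_ge0.
  have := sum0 k; lra.
have c0 : 0 <= c by rewrite addr_ge0.
exists c => // k; case: (leqP k N) => [/small //|/ltnW/subnKC <-].
elim: (k - N)%N => [|j IH]; first by rewrite addn0; exact: small.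
rewrite addnS; apply: le_trans (rec _ (leq_addr _ _)) _.
have gj := g0 (N + j)%N.
have cA : A <= c * (a / 2).
  rewrite -ler_pdivrMr ?divr_gt0 //.
  have -> : A / (a / 2) = 2 * A / a by field; rewrite gt_eqF.
  by rewrite /c; have := sum0 N.+1; lra.
apply: le_trans (_ : c * ((1 - a / 2) * g (N + j)%N) <= _); last first.
  by rewrite ler_wpM2l // slow // leq_addr.
have h1 : (1 - a) * V (N + j)%N <= (1 - a) * (c * g (N + j)%N).
  by rewrite ler_wpM2l // subr_ge0.
have : A * g (N + j)%N <= c * (a / 2) * g (N + j)%N by rewrite ler_wpM2r // ltW.
lra.
Qed.

(* The delayed term is absorbed in the potential [e k + a / 4 * e' k]. *)
Lemma delayed_contraction (e e' g : nat -> R) a A B : 0 < a <= 1 -> 0 <= A ->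
  (forall k, 0 <= e k) -> (forall k, 0 <= e' k) -> (forall k, e' k.+1 = e k) ->
  (forall k, 0 <= g k) -> g @ \oo --> 0 ->
  (forall k, e k.+1 <= (1 - a) * e k + g k * (A + B * e k + B * e' k)) ->
  exists N, forall k, (N <= k)%N ->
    e k.+1 + a / 4 * e' k.+1 <= (1 - a / 2) * (e k + a / 4 * e' k) + A * g k.
Proof.
move=> /andP[a0 a1] A0 e0 e'0 e'S g0 g_to0 rec.
(* With [g k * B <= a / 8] the coefficient of [e k] becomes [1 - a + a / 8 + a / 4 <= 1 - a / 2],
   and that of [e' k] is [a / 8 <= (1 - a / 2) * (a / 4)] because [a <= 1]. *)
have [N NP] : exists N, forall k, (N <= k)%N -> g k * B <= a / 8.
  have /cvgrPdist_le : g k * B @[k --> \oo] --> 0.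
    by rewrite -(mul0r B); apply: cvgM => //; exact: cvg_cst.
  move=> /(_ (a / 8)) []; first by rewrite divr_gt0.
  move=> N _ NP; exists N => k /NP /=; rewrite sub0r normrN; exact/le_trans/ler_norm.
exists N => k /NP gB; rewrite e'S; apply: le_trans (lerD (rec k) (lexx _)) _.
have : g k * B * (e k + e' k) <= a / 8 * (e k + e' k).
  by rewrite ler_wpM2r // addr_ge0.
have : 0 <= a * (1 - a) * e' k by rewrite !mulr_ge0 ?subr_ge0 // ltW.
have := e0 k; have := e'0 k; have : 0 <= a * e k by rewrite mulr_ge0 // ltW.
have : 0 <= a * e' k by rewrite mulr_ge0 // ltW.
lra.
Qed.

End recursion.

(** * Measurability and conditioning *)

Section measurable_vectors.
Context d (T : measurableType d) (R : realType) (n : nat).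
Implicit Types (x : T -> 'rV[R]_n).

(** An open set is the countable union of the rational boxes it contains, and the preimage of a box
    is a finite intersection of coordinate preimages. *)
Lemma open_preimage_measurable x (U : set 'rV[R]_n) :
  (forall j, measurable_fun setT (fun a => x a 0 j)) -> open U ->
  measurable (x @^-1` U).
Proof.
move=> mx oU.
pose box (q : 'rV[rat]_n * 'rV[rat]_n) (v : 'rV[R]_n) :=
  forall j, v 0 j \in `]ratr (q.1 0 j), ratr (q.2 0 j)[.
(* The union runs over all pairs of rational vectors, a countable type; boxes not contained in [U]
   contribute [set0]. *)
have -> : x @^-1` U = \bigcup_q
    if `[< forall v, box q v -> U v >]
    then \bigcap_(j in [set: 'I_n])
      (fun a => x a 0 j) @^-1` `]ratr (q.1 0 j), ratr (q.2 0 j)[%classic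
    else set0.
  apply/seteqP; split => a /=; last first.
    move=> [q _]; case: asboolP => // qU qa; apply: qU => j.
    by have /= := qa j I.
  move=> Ua; have /nbhs_ballP[e /= e0 eU] : nbhs (x a) U by exact: open_nbhs_nbhs.
  have ratl (j : 'I_n) : exists q : rat, ratr q \in `]x a 0 j - e, x a 0 j[.
    by apply: rat_in_itvoo; rewrite gtrBl.
  have ratR (j : 'I_n) : exists q : rat, ratr q \in `]x a 0 j, x a 0 j + e[.
    by apply: rat_in_itvoo; rewrite ltrDl.
  move: ratl ratR => /choice[f fP] /choice[g gP].
  exists (\row_j f j, \row_j g j) => //.
  case: asboolP => [_ j _ /=|[]].
    move: (fP j) (gP j); rewrite !mxE !in_itv /= => /andP[_ ->] /andP[-> _] //.
  move=> v vq; apply: eU; split => // i j; rewrite (ord1 i).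
  move: (vq j) (fP j) (gP j); rewrite !mxE !in_itv /= /ball /= => /andP[h1 h2].
  move=> /andP[h3 h4] /andP[h5 h6]; rewrite ltr_norml; apply/andP; split; lra.
apply: countable_bigcupT_measurable; first exact: countableP.
move=> q; case: ifP => // _; apply: fin_bigcap_measurable => // j _.
by rewrite -[X in measurable X]setTI; apply: mx => //; exact: measurable_itv.
Qed.

Lemma continuous_sqnB y : continuous (fun v : 'rV[R]_n => sqn (v - y)).
Proof.
suff H s : continuous (fun v : 'rV[R]_n => \sum_(j <- s) (v - y) 0 j ^+ 2) by exact: H.
elim: s => [|j s IH] v.
  by under eq_fun do rewrite big_nil; exact: cst_continuous.
have cj : (fun v : 'rV[R]_n => (v - y) 0 j) @ v --> (v - y) 0 j.
  under eq_fun do rewrite !mxE; rewrite !mxE.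
  apply: (@cvgB R R^o _ (nbhs v) _ (fun v : 'rV[R]_n => v 0 j) (fun=> y 0 j)).
    exact: (@coord_continuous R 1 n 0 j v).
  exact: cvg_cst.
rewrite /continuous_at; under eq_fun do rewrite big_cons expr2.
rewrite big_cons expr2; apply: (@cvgD R R^o _ (nbhs v) _
  (fun u : 'rV[R]_n => (u - y) 0 j * (u - y) 0 j)
  (fun u : 'rV[R]_n => \sum_(i <- s) (u - y) 0 i ^+ 2)); last exact: IH.
exact: (@cvgM R _ (nbhs v)).
Qed.

(* The squared distance is an infimum of continuous functions, hence upper
   semicontinuous. *)
Lemma measurable_sqdist x (A : set 'rV[R]_n) pr :
  (forall z, is_proj A z (pr z)) ->
  (forall j, measurable_fun setT (fun a => x a 0 j)) ->
  measurable_fun setT (fun a => sqdist pr (x a)).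
Proof.
move=> prP mx; apply: (measurability _ (RGenInftyO.measurableE R)).
move=> /= _ [_ [r ->]] <-; apply: measurableI => //.
have -> : (fun a => sqdist pr (x a)) @^-1` `]-oo, r[%classic =
    x @^-1` (\bigcup_(y in A) [set v | sqn (v - y) < r]).
  apply/seteqP; split => a /=; rewrite in_itv /=.
    by move=> h; exists (pr (x a)) => //; exact: (prP _).1.
  by move=> [y Ay]; apply: le_lt_trans; exact: proj_min.
apply: open_preimage_measurable => //; apply: bigcup_open => y _.
by apply: open_comp (@open_lt R r) => v _; exact: continuous_sqnB.
Qed.

End measurable_vectors.

(** * Integrals of functions measurable for a sub-sigma-algebra *)

Section sub_sigma_algebra.
Context d (T : measurableType d) (R : realType) (mu : {measure set T -> \bar R}).
Variables (C : set (set T)).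
Hypothesis CT : C `<=` measurable.

Import HBNNSimple.

Let S : measurableType _ := g_sigma_algebraType C.

Lemma g_sigma_measurable (A : set T) : <<s C >> A -> measurable A.
Proof. by apply: smallest_sub => //; exact: sigma_algebra_measurable. Qed.

Lemma measurable_funS_sigma d' (U : measurableType d') (f : T -> U) :
  measurable_fun (setT : set S) f -> measurable_fun setT f.
Proof. by move=> mf _ Y mY; exact: g_sigma_measurable (mf measurableT Y mY). Qed.

Lemma Gmeas_measurable (f : T -> R) :
  Gmeas <<s C >> f -> measurable_fun (setT : set S) f.
Proof. by move=> mf _ Y mY; rewrite setTI; exact: mf. Qed.

(* If P(E | C) >= c then E[g 1_E] >= c E[g] for every C-measurable g. *)
Lemma sub_sigma_integral_le (E : set T) (c : R) (g : T -> \bar R) :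
  measurable E -> 0 <= c ->
  (forall A, <<s C >> A -> (c%:E * mu A <= mu (A `&` E))%E) ->
  (forall a, (0 <= g a)%E) -> measurable_fun (setT : set S) g ->
  (c%:E * \int[mu]_a g a <= \int[mu]_(a in E) g a)%E.
Proof.
move=> mE c0 muC g0 mg; have mgT := measurable_funS_sigma mg.
(* The identity into the coarser space turns the integral of [g] into one against a pushforward.
   That one is a supremum over simple functions whose level sets lie in [<<s C >>], where [muC]
   applies. *)
have mid : measurable_fun setT (id : T -> S).
  by move=> _ Y mY; rewrite setTI; exact: g_sigma_measurable.
have : (\int[pushforward mu (id : T -> S)]_a g a = \int[mu]_a g a)%E.
  by rewrite ge0_integral_pushforward.
move=> <-; rewrite ge0_integralTE //.
move: c0; rewrite le_eqVlt => /predU1P[<-|c0].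
  by rewrite mul0e; exact: integral_ge0.
rewrite -lee_pdivlMl //; apply: ge_ereal_sup => _ [h /= hg <-].
rewrite lee_pdivlMl //.
have hg' (a : T) : (((h : S -> R) a)%:E <= g a)%E by exact: hg.
have mh (r : R) : measurable ((h : S -> R) @^-1` [set r] : set T).
  by apply: g_sigma_measurable; have := @measurable_funPTI _ _ S R h _ (measurable_set1 r).
have h0 (a : T) : 0 <= (h : S -> R) a by exact: fun_ge0.
(* The layer of [h] at height [r]; it is nonnegative for every [r], because a nonempty level set
   forces [r >= 0]. *)
pose f (r : R) (a : T) : \bar R := (r * \1_((h : S -> R) @^-1` [set r] : set T) a)%:E.
have f0 r (a : T) : (0 <= f r a)%E.
  rewrite /f lee_fin indicE; case: (boolP (_ \in _)); last by rewrite mulr0.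
  by rewrite inE /= => <-; rewrite mulr1.
have mf r : measurable_fun setT (f r).
  by apply/measurable_EFinP/measurable_funM => //; exact: measurable_indic.
have hE (a : T) : ((h : S -> R) a)%:E = \sum_(r \in range h) f r a.
  by rewrite (fimfunE h) fsumEFin.
apply: (@le_trans _ _ (\int[mu]_(a in E) (\sum_(r \in range h) f r a))%E).
  rewrite ge0_integral_fsum //; last by move=> r; exact: measurable_funTS.
  rewrite sintegralE ge0_mule_fsumr; last by move=> r; exact: nnsfun_mulemu_ge0.
  apply: lee_fsum => // r [b _ <-]; rewrite /f.
  under eq_integral do rewrite EFinM.
  rewrite ge0_integralZl_EFin //; last first.
    by apply/measurable_EFinP/measurable_funTS; exact: measurable_indic.
  rewrite integral_indic // muleCA lee_wpmul2l ?lee_fin //.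
  by apply: muC; exact: (@measurable_funPTI _ _ S).
apply: ge0_le_integral => //.
- by move=> a _; rewrite -hE lee_fin.
- under eq_fun do rewrite -hE.
  apply: measurable_funTS; apply/measurable_EFinP.
  exact: (@measurable_funS_sigma _ _ (h : S -> R)).
- exact: measurable_funTS.
- by move=> a _; rewrite -hE.
Qed.

End sub_sigma_algebra.

(** * From conditional probabilities to probabilities of intersections *)

Section conditional_probability.
Context d (T : measurableType d) (R : realType) (P : probability T R).

Lemma cond_prob_ge (C : set (set T)) (b : T -> bool) (c : R) Z :
  C `<=` measurable -> measurable [set a | b a] -> 0 <= c ->
  cond_exp P <<s C >> (fun a => (b a)%:R) Z -> {ae P, forall a, c <= Z a} ->
  forall A, <<s C >> A -> (c%:E * P A <= P (A `&` [set a | b a]))%E.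
Proof.
move=> CT mb c0 [_ mZ _ ZP] cZ A CA.
have mA := g_sigma_measurable CT CA.
have mZT : measurable_fun setT Z := measurable_funS_sigma CT (Gmeas_measurable mZ).
have := ZP A CA.
have -> : (\int[P]_(a in A) (b a)%:R%:E = P (A `&` [set a | b a]))%E.
  rewrite setIC -integral_indic //; apply: eq_integral => a _.
  rewrite indicE; case: (boolP (b a)) => ba; first by rewrite mem_set.
  by rewrite memNset // => /=; exact/negP.
move=> ->; rewrite -integral_cst //.
(* [Num.max (Z a) c] agrees with [Z] almost everywhere and is at least [c] at every point, which
   gives monotonicity of the integral a pointwise inequality. *)
apply: le_trans (_ : (\int[P]_(a in A) (Num.max (Z a) c)%:E <= _)%E).
  apply: ge0_le_integral => //.
  - by apply/measurable_EFinP/measurable_funTS/measurable_maxr.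
  - by move=> a _; rewrite lee_fin le_max lexx orbT.
rewrite le_eqVlt; apply/orP; left; apply/eqP.
apply: ae_eq_integral => //.
- by apply/measurable_EFinP/measurable_funTS/measurable_maxr.
- by apply/measurable_EFinP/measurable_funTS.
- by move: cZ; apply: filterS => a /= cZa _; rewrite max_l.
Qed.

End conditional_probability.

(** * The projected step *)

Section projection_step.
Variables (R : realType) (n : nat).
Implicit Types (X A : set 'rV[R]_n) (u v G : 'rV[R]_n).

(** Pythagoras leaves a spare term [sqn (z - prA z)] on the left, and [h4] shows that it pays for
    half the squared distance of [u] to [A] up to [g ^+ 2 * sqn G]. *)
Lemma projected_step X A prX prA u G g e :
  X `<=` A -> convex_set A ->
  (forall v, is_proj X v (prX v)) -> (forall v, is_proj A v (prA v)) -> 0 < e ->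
  sqdist prX (prA (u - g *: G)) + sqdist prA u / 2 <=
  (1 + e) * sqdist prX u + (2 + e^-1) * g ^+ 2 * sqn G.
Proof.
move=> XA cA prXP prAP e0; set z := u - g *: G.
have h1 : sqdist prX (prA z) <= sqn (prA z - prX u).
  by apply: proj_min; [exact: prXP | exact: (prXP u).1].
have h2 := proj_pythagoras cA (prAP z) (XA _ (prXP u).1).
have h3 : sqn (z - prX u) <= (1 + e) * sqdist prX u + (1 + e^-1) * (g ^+ 2 * sqn G).
  have -> : z - prX u = (u - prX u) + (- g) *: G by rewrite scaleNr addrAC.
  by apply: le_trans (sqnD_young _ _ e0) _; rewrite sqnZ sqrrN.
have h4 : sqdist prA u <= 2 * (g ^+ 2 * sqn G) + 2 * sqn (z - prA z).
  apply: le_trans (proj_min (prAP u) (prAP z).1) _.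
  have -> : u - prA z = g *: G + (z - prA z).
    by rewrite /z addrA addrCA subrr addr0.
  by apply: le_trans (sqnD_le _ _) _; rewrite sqnZ.
lra.
Qed.

(** Any point is within its distance to [X] plus the diameter from a fixed anchor [u0] of [X], so
    [y] and, by the Lipschitz bound, [F y] grow at most affinely in the squared distances. *)
Lemma oracle_growth X prX (F : 'rV[R]_n -> 'rV[R]_n) L D :
  (exists v, X v) -> (forall v, is_proj X v (prX v)) ->
  (forall u v, X u -> X v -> enorm (u - v) ^+ 2 <= D ^+ 2) ->
  0 < L -> (forall u v, enorm (F u - F v) <= L * enorm (u - v)) ->
  exists2 c, 0 <= c & forall u v G, let y := 2 *: u - v in
    sqn y <= c * (1 + sqdist prX u + sqdist prX v) /\
    sqn G <= c * (1 + sqdist prX u + sqdist prX v) + 2 * sqn (G - F y).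
Proof.
move=> [u0 Xu0] prXP diam L0 lip.
have near v : sqn (v - u0) <= 2 * sqdist prX v + 2 * D ^+ 2.
  have -> : v - u0 = (v - prX v) + (prX v - u0) by rewrite addrA subrK.
  apply: le_trans (sqnD_le _ _) _; rewrite lerD2l ler_wpM2l //.
  by rewrite -enorm_sqr; apply: diam => //; exact: (prXP v).1.
have D2 : 0 <= D ^+ 2 := sqr_ge0 _.
(* The two uses of [near] give [16 * du + 4 * dv + 20 * D ^+ 2]. *)
pose c1 : R := 16 + 20 * D ^+ 2.
have ynear u v : sqn (2 *: u - v - u0) <= c1 * (1 + sqdist prX u + sqdist prX v).
  have -> : 2 *: u - v - u0 = 2 *: (u - u0) + (-1) *: (v - u0).
    by apply/rowP => j; rewrite !mxE; ring.
  apply: le_trans (sqnD_le _ _) _; rewrite !sqnZ.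
  have := near u; have := near v.
  have := sqdist_ge0 prX u; have := sqdist_ge0 prX v.
  set du := sqdist _ u; set dv := sqdist _ v => dv0 du0.
  have : 0 <= D ^+ 2 * du by rewrite mulr_ge0.
  have : 0 <= D ^+ 2 * dv by rewrite mulr_ge0.
  rewrite /c1; lra.
have c10 : 0 <= c1 by rewrite /c1; lra.
pose c := 2 * c1 + 2 * sqn u0 + (4 * sqn (F u0) + 4 * L ^+ 2 * c1).
have ge1 u v : 1 <= 1 + sqdist prX u + sqdist prX v.
  by rewrite -addrA lerDl addr_ge0 // sqdist_ge0.
have s0 := sqn_ge0 u0; have sF0 := sqn_ge0 (F u0).
have Lc0 : 0 <= L ^+ 2 * c1 by rewrite mulr_ge0 ?sqr_ge0.
exists c => [|u v G]; first by rewrite /c; lra.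
move: (ynear u v) (ge1 u v); set S := 1 + _ + _ => yS S1; set y := 2 *: u - v.
have S0 : 0 <= S by lra.
have sS : sqn u0 <= sqn u0 * S by rewrite ler_peMr.
have sFS : sqn (F u0) <= sqn (F u0) * S by rewrite ler_peMr.
have LcS : 0 <= L ^+ 2 * c1 * S by rewrite mulr_ge0.
have c1S : 0 <= c1 * S by rewrite mulr_ge0.
split.
  have -> : y = (y - u0) + u0 by rewrite subrK.
  apply: le_trans (sqnD_le _ _) _; rewrite /c; lra.
have hG : sqn G <= 2 * sqn (F y) + 2 * sqn (G - F y).
  by apply: le_trans (sqnD_le _ _); rewrite addrCA subrr addr0.
have hF : sqn (F y) <= 2 * sqn (F u0) + 2 * sqn (F y - F u0).
  by apply: le_trans (sqnD_le _ _); rewrite addrCA subrr addr0.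
have hL : sqn (F y - F u0) <= L ^+ 2 * (c1 * S).
  apply: le_trans (_ : L ^+ 2 * sqn (y - u0) <= _); last first.
    by rewrite ler_wpM2l ?sqr_ge0.
  rewrite -!enorm_sqr -exprMn ler_pXn2r ?nnegrE ?enorm_ge0 //.
  by rewrite mulr_ge0 ?enorm_ge0 // ltW.
rewrite /c; lra.
Qed.

End projection_step.

(** * Expectations of nonnegative functions *)

Section expectation.
Context d (T : measurableType d) (R : realType) (P : probability T R).
Implicit Types f g : T -> R.

(** Nonnegativity keeps the identity valid for infinite expectations, so it can be applied before
    finiteness is established. *)
Lemma expect_lin f g a b : 0 <= a -> 0 <= b ->
  (forall x, 0 <= f x) -> (forall x, 0 <= g x) ->
  measurable_fun setT f -> measurable_fun setT g ->
  (\int[P]_x (a * f x + b * g x)%:E =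
   a%:E * \int[P]_x (f x)%:E + b%:E * \int[P]_x (g x)%:E)%E.
Proof.
move=> a0 b0 f0 g0 mf mg; under eq_integral do rewrite EFinD !EFinM.
rewrite ge0_integralD //; first last.
- by apply: measurable_funeM; exact/measurable_EFinP.
- by move=> x _; rewrite -EFinM lee_fin mulr_ge0.
- by apply: measurable_funeM; exact/measurable_EFinP.
- by move=> x _; rewrite -EFinM lee_fin mulr_ge0.
by rewrite !ge0_integralZl_EFin // => *; rewrite ?lee_fin //; exact/measurable_EFinP.
Qed.

Lemma expect_le f g : (forall x, 0 <= f x) ->
  measurable_fun setT f -> measurable_fun setT g -> (forall x, f x <= g x) ->
  (\int[P]_x (f x)%:E <= \int[P]_x (g x)%:E)%E.
Proof.
by move=> f0 mf mg fg; apply: ge0_le_integral => // *;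
  rewrite ?lee_fin //; exact/measurable_EFinP.
Qed.

Lemma expect_cst (c : R) : (\int[P]_x c%:E = c%:E)%E.
Proof. by rewrite integral_cst //= probability_setT mule1. Qed.

Lemma expect_affine f g c r s : 0 <= c ->
  (forall x, 0 <= f x) -> (forall x, 0 <= g x) ->
  measurable_fun setT f -> measurable_fun setT g ->
  (\int[P]_x (f x)%:E = r%:E)%E -> (\int[P]_x (g x)%:E = s%:E)%E ->
  (\int[P]_x (c * (1 + f x + g x))%:E = (c * (1 + r + s))%:E)%E.
Proof.
move=> c0 f0 g0 mf mg Ef Eg.
have mfg : measurable_fun setT (fun x => 1 * f x + 1 * g x).
  by apply: measurable_funD; apply: measurable_funM.
transitivity (\int[P]_x (c * 1 + c * (1 * f x + 1 * g x))%:E)%E.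
  by apply: eq_integral => x _; congr EFin; ring.
rewrite expect_lin // => [|x]; last by rewrite !mul1r addr_ge0.
by rewrite expect_cst expect_lin // Ef Eg -!EFinM -!EFinD; congr EFin; ring.
Qed.

End expectation.

(** * The random iterates and the recursion for their expected squared distance *)

Section process.
Variables (R : realType) (n m : nat) (m_gt0 : (0 < m)%N).
Variables (Xs : 'I_m -> set 'rV[R]_n).
Variables (proj : 'I_m -> 'rV[R]_n -> 'rV[R]_n) (projX : 'rV[R]_n -> 'rV[R]_n).
Variables (DX : R) (F : 'rV[R]_n -> 'rV[R]_n) (L eta : R) (rho : 'I_m -> R).
Context d (T : measurableType d) (P : probability T R).
Context d' (Xi : measurableType d').
Variables (omega : nat -> T -> Xi) (l : nat -> T -> 'I_m).
Variables (Fo : 'rV[R]_n -> Xi -> 'rV[R]_n) (nu1 nu2 : R).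
Variables (gamma : nat -> R) (xm1 x0 : 'rV[R]_n) (x : nat -> T -> 'rV[R]_n).

Let X := [set v | forall i, Xs i v].
Let Fk := hist_filtration l omega.
Let xp := xprev xm1 x.
Let y k a := 2 *: x k a - xp k a.
Let w k a := Fo (y k a) (omega k a) - F (y k a).
Let rho_min := \big[Num.min/1]_(i < m) rho i.

Hypothesis Xs_convex : forall i, convex_set (Xs i).
Hypothesis X_nonempty : exists v, X v.
Hypothesis projP : forall i v, is_proj (Xs i) v (proj i v).
Hypothesis projXP : forall v, is_proj X v (projX v).
Hypothesis X_bounded : forall u v, X u -> X v -> enorm (u - v) ^+ 2 <= DX ^+ 2.
Hypothesis L_gt0 : 0 < L.
Hypothesis F_lip : forall u v, enorm (F u - F v) <= L * enorm (u - v).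
Hypothesis l_meas : forall j i, measurable (l j @^-1` [set i]).
Hypothesis omega_meas : forall j, measurable_fun setT (omega j).
Hypothesis x_adapted : forall k j, Gmeas (Fk k) (fun a => x k a 0 j).
Hypothesis x_init : forall a, x 0%N a = x0.
Hypothesis x_step : forall k a,
  x k.+1 a = proj (l k a) (x k a - gamma k *: Fo (y k a) (omega k a)).
Hypothesis noise : forall k,
  exists Z, cond_exp_nneg P (Fk k) (fun a => enorm (w k a) ^+ 2) Z /\
  {ae P, forall a, (Z a <= (nu1 ^+ 2 * enorm (y k a) ^+ 2 + nu2 ^+ 2)%:E)%E}.
Hypothesis eta_gt0 : 0 < eta.
Hypothesis regular : forall v, enorm (v - projX v) ^+ 2 <=
  eta * \big[Num.max/0]_(i < m) (enorm (v - proj i v) ^+ 2).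
Hypothesis rho_01 : forall i, 0 < rho i <= 1.
Hypothesis sampling : forall i k,
  exists Z, cond_exp P (Fk k) (fun a => (l k a == i)%:R) Z /\
            {ae P, forall a, rho i / m%:R <= Z a}.

Lemma rho_min_gt0 : 0 < rho_min.
Proof.
by rewrite /rho_min; elim/big_ind: _ => // [a b a0 b0|i _];
  [rewrite lt_min a0 | case/andP: (rho_01 i)].
Qed.

Lemma rho_min_le i : rho_min <= rho i.
Proof. by rewrite /rho_min (bigD1 i) //= ge_min lexx. Qed.

Lemma rho_min_le1 : rho_min <= 1.
Proof.
apply: le_trans (rho_min_le (Ordinal m_gt0)) _.
by case/andP: (rho_01 (Ordinal m_gt0)).
Qed.

Lemma sqdist_le_max v :
  sqdist projX v <= eta * \big[Num.max/0]_(i < m) sqdist (proj i) v.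
Proof.
have := regular v; rewrite enorm_sqr; under eq_bigr do rewrite enorm_sqr.
exact.
Qed.

(** Since [X] lies in every [Xs i], no distance to [Xs i] exceeds the distance to [X]; regularity at
    a point outside [X] then forces the bound. It serves to show that the contraction constant is at
    most 1. *)
Lemma eta_ge1 : (0 < n)%N -> 1 <= eta.
Proof.
move=> n0; have [u0 Xu0] := X_nonempty.
(* At distance 0 from [X], boundedness would give [sqn (v - u0) <= 2 * DX ^+ 2], which is less than
   the square of a single coordinate of the shift. *)
pose v := u0 + const_mx (1 + 2 * `|DX|).
have dv : 0 < sqdist projX v.
  rewrite lt_def sqdist_ge0 andbT; apply/eqP => dv0.
  have vE : v - u0 = (v - projX v) + (projX v - u0) by rewrite addrA subrK.
  have := sqnD_le (v - projX v) (projX v - u0).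
  rewrite -vE [sqn (v - projX v)]dv0 mulr0 add0r -(enorm_sqr (projX v - u0)).
  have := X_bounded (projXP v).1 Xu0.
  have -> : sqn (v - u0) = n%:R * (1 + 2 * `|DX|) ^+ 2.
    rewrite /sqn (eq_bigr (fun=> (1 + 2 * `|DX|) ^+ 2)).
      by rewrite sumr_const card_ord [RHS]mulr_natl.
    by move=> j _; rewrite !mxE addrAC subrr add0r.
  have n1 : 1 <= n%:R :> R by rewrite ler1n.
  have s0 : 0 <= (1 + 2 * `|DX|) ^+ 2 by rewrite sqr_ge0.
  have : (1 + 2 * `|DX|) ^+ 2 <= n%:R * (1 + 2 * `|DX|) ^+ 2 by rewrite ler_peMl.
  rewrite -(real_normK (num_real DX)); have := normr_ge0 DX.
  have := sqr_ge0 `|DX|.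
  by move: `|DX| => b; rewrite !expr2; nra.
rewrite -(ler_pM2r dv) mul1r; apply: le_trans (sqdist_le_max v) _.
rewrite ler_wpM2l ?(ltW eta_gt0) //; apply: bigmax_le => [|i _].
  exact: sqdist_ge0.
by apply: proj_min; [exact: projP | exact: (projXP v).1].
Qed.

Let C k : set (set T) := [set A | exists2 j, (j < k)%N &
  (exists i, A = l j @^-1` [set i]) \/
  (exists2 B : set Xi, measurable B & A = omega j @^-1` B)].

Let C_meas k : C k `<=` measurable.
Proof.
move=> A [j _ [[i ->]|[B mB ->]]]; first exact: l_meas.
by rewrite -[X in measurable X]setTI; exact: omega_meas.
Qed.

Let x_measG k j :
  measurable_fun (setT : set (g_sigma_algebraType (C k))) (fun a => x k a 0 j).
Proof. by apply: Gmeas_measurable; exact: x_adapted. Qed.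

Lemma iterate_measurable k j : measurable_fun setT (fun a => x k a 0 j).
Proof. by apply: (measurable_funS_sigma (@C_meas k)); exact: x_measG. Qed.

Let xp_meas k j : measurable_fun setT (fun a => xp k a 0 j).
Proof. by case: k => [|k] /=; [exact: measurable_cst | exact: iterate_measurable]. Qed.

Let D k a := sqdist projX (x k a).
Let Dp k a := sqdist projX (xp k a).

Let D_ge0 k a : 0 <= D k a. Proof. exact: sqdist_ge0. Qed.
Let Dp_ge0 k a : 0 <= Dp k a. Proof. exact: sqdist_ge0. Qed.

Let D_meas k : measurable_fun setT (D k).
Proof. exact: measurable_sqdist projXP (iterate_measurable k). Qed.

Let Dp_meas k : measurable_fun setT (Dp k).
Proof. exact: measurable_sqdist projXP (xp_meas k). Qed.

Let hit_meas k i : measurable [set a | l k a == i].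
Proof.
have -> : [set a | l k a == i] = l k @^-1` [set i] by apply/seteqP; split => a /= /eqP.
exact: l_meas.
Qed.

Let H k a := sqdist (proj (l k a)) (x k a).

(** Splitting by the value of the index gives measurability of the randomly selected distance and
    lets the sampling bound act on one set at a time. *)
Let HE k : H k = fun a => \sum_(i < m) (\1_[set a | l k a == i] a * sqdist (proj i) (x k a)).
Proof.
apply/funext => a; rewrite (bigD1 (l k a)) //= indicE mem_set //= mul1r big1 ?addr0 //.
by move=> i il; rewrite indicE memNset ?mul0r //= => /eqP e; rewrite e eqxx in il.
Qed.

Let H_meas k : measurable_fun setT (H k).
Proof.
rewrite HE; apply: measurable_sum => i; apply: measurable_funM.
  exact: measurable_indic.
exact: measurable_sqdist (projP i) (iterate_measurable k).
Qed.

(** The distance of [x k] to each fixed [Xs i] is determined by the history, so restricting it to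
    the event [l k a == i] keeps at least the fraction [rho i / m%:R] of its expectation. *)
Lemma expected_projection_gain k :
  ((rho_min / (m%:R * eta))%:E * \int[P]_a (D k a)%:E <= \int[P]_a (H k a)%:E)%E.
Proof.
(* The sum over [i] dominates the maximum in the regularity condition and commutes with the
   expectation. *)
pose S a := \sum_(i < m) sqdist (proj i) (x k a).
have mi i : measurable_fun setT (fun a => sqdist (proj i) (x k a)).
  exact: measurable_sqdist (projP i) (iterate_measurable k).
have mS : measurable_fun setT S by exact: measurable_sum.
have S0 a : 0 <= S a by apply: sumr_ge0 => i _; exact: sqdist_ge0.
have m0 : 0 < m%:R :> R by rewrite ltr0n.
have rm0 : 0 <= rho_min / m%:R by rewrite divr_ge0 ?(ltW m0) // (ltW rho_min_gt0).
have DS a : D k a / eta <= S a.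
  rewrite ler_pdivrMr // mulrC; apply: le_trans (sqdist_le_max _) _.
  rewrite ler_wpM2l ?(ltW eta_gt0) //; apply: bigmax_le => // i _.
  by rewrite /S (bigD1 i) //= lerDl sumr_ge0 // => j _; exact: sqdist_ge0.
apply: (@le_trans _ _ ((rho_min / m%:R)%:E * \int[P]_a (S a)%:E)%E).
  have -> : rho_min / (m%:R * eta) = rho_min / m%:R * eta^-1.
    by rewrite invfM mulrA.
  rewrite EFinM -muleA lee_wpmul2l ?lee_fin // -ge0_integralZl_EFin //.
  - under eq_integral do rewrite -EFinM mulrC.
    by apply: expect_le => // [a|]; [rewrite mulr_ge0 // invr_ge0 ltW | exact: measurable_funM].
  - by move=> a _; rewrite lee_fin.
  - exact/measurable_EFinP.
  - by rewrite invr_ge0 ltW.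
rewrite HE; under [X in (_ * X)%E]eq_integral do rewrite -sumEFin.
under [X in (_ <= X)%E]eq_integral do rewrite -sumEFin.
rewrite ge0_integral_sum //; last 2 first.
- by move=> i; exact/measurable_EFinP.
- by move=> i a _; rewrite lee_fin sqdist_ge0.
rewrite ge0_integral_sum //; last 2 first.
- by move=> i; apply/measurable_EFinP/measurable_funM => //; exact: measurable_indic.
- by move=> i a _; rewrite lee_fin mulr_ge0 ?sqdist_ge0 // indicE.
rewrite ge0_sume_distrr; last by move=> i _; apply: integral_ge0 => a _; rewrite lee_fin sqdist_ge0.
apply: lee_sum => i _.
have -> : (\int[P]_a (\1_[set a | l k a == i] a * sqdist (proj i) (x k a))%:E =
    \int[P]_(a in [set a | l k a == i]) (sqdist (proj i) (x k a))%:E)%E.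
  rewrite [RHS]integral_mkcond; apply: eq_integral => a _.
  rewrite patchE indicE; case: ifP => _; by rewrite ?mul1r ?mul0r.
have [Z [ZP cZ]] := sampling i k.
have ri0 : 0 <= rho i / m%:R.
  by rewrite divr_ge0 ?(ltW m0) //; case/andP: (rho_01 i) => /ltW.
apply: (@le_trans _ _ ((rho i / m%:R)%:E * \int[P]_a (sqdist (proj i) (x k a))%:E)%E).
  apply: lee_wpmul2r; first by apply: integral_ge0 => a _; rewrite lee_fin sqdist_ge0.
  by rewrite lee_fin ler_wpM2r ?invr_ge0 ?(ltW m0) // rho_min_le.
apply: (sub_sigma_integral_le (@C_meas k)) => //.
- by move=> A CA; apply: (cond_prob_ge (@C_meas k) _ ri0 ZP cZ CA).
- by move=> a; rewrite lee_fin sqdist_ge0.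
- apply/measurable_EFinP.
  (* Measurability is required here for the history, not merely for the ambient sigma-algebra. *)
  exact: (@measurable_sqdist _ (g_sigma_algebraType (C k)) R n (x k) _ _ (projP i) (@x_measG k)).
Qed.

Let kappa := rho_min / (m%:R * eta).

Let kappa_gt0 : 0 < kappa.
Proof. by rewrite divr_gt0 ?rho_min_gt0 // mulr_gt0 ?ltr0n. Qed.

Let W_meas k : measurable_fun setT (fun a => sqn (w k a)).
Proof.
have [Z [[mw _ _ _ _] _]] := noise k.
by move: mw; under eq_fun do rewrite enorm_sqr.
Qed.

Lemma expected_noise : exists2 c, 0 <= c & forall k r s,
  (\int[P]_a (D k a)%:E = r%:E)%E -> (\int[P]_a (Dp k a)%:E = s%:E)%E ->
  (\int[P]_a (sqn (w k a))%:E <= (c * (1 + r + s))%:E)%E.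
Proof.
have [c c0 growth] := oracle_growth X_nonempty projXP X_bounded L_gt0 F_lip.
have b0 : 0 <= nu1 ^+ 2 * c + nu2 ^+ 2.
  by rewrite addr_ge0 ?sqr_ge0 // mulr_ge0 ?sqr_ge0.
exists (nu1 ^+ 2 * c + nu2 ^+ 2) => // k r s Er Es.
have [Z [[_ _ mZ Z0 ZP] Zle]] := noise k.
have -> : (\int[P]_a (sqn (w k a))%:E = \int[P]_a Z a)%E.
  (* Taking the whole space as test set removes the conditioning. *)
  rewrite -ZP; last exact: (@measurableT _ (g_sigma_algebraType (C k))).
  by apply: eq_integral => a _; rewrite enorm_sqr.
rewrite -(expect_affine (P := P) (f := D k) (g := Dp k)) //.
have S1 a : 1 <= 1 + D k a + Dp k a by rewrite -addrA lerDl addr_ge0.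
apply: ae_ge0_le_integral => //.
- by move=> _ B mB; apply: (g_sigma_measurable (@C_meas k)); rewrite setTI; exact: mZ.
- by move=> a _; rewrite lee_fin mulr_ge0 // (le_trans ler01).
- apply/measurable_EFinP; apply: measurable_funM => //.
  by apply: measurable_funD => //; exact: measurable_funD.
apply: filterS Zle => a Za _; apply: le_trans Za _; rewrite lee_fin enorm_sqr.
have [hy _] := growth (x k a) (xp k a) 0.
rewrite mulrDl lerD //.
  by rewrite -[leRHS]mulrA; exact: ler_wpM2l (sqr_ge0 nu1) _ _ hy.
by rewrite ler_peMr ?sqr_ge0.
Qed.

Lemma expected_sqdist_step : exists2 A, 0 <= A & forall k r s,
  (\int[P]_a (D k a)%:E = r%:E)%E -> (\int[P]_a (Dp k a)%:E = s%:E)%E ->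
  (\int[P]_a (D k.+1 a)%:E <=
     ((1 - kappa / 4) * r + gamma k ^+ 2 * (A + A * r + A * s))%:E)%E.
Proof.
have [c c0 growth] := oracle_growth X_nonempty projXP X_bounded L_gt0 F_lip.
have [c2 c20 noise_le] := expected_noise.
have k40 : 0 < kappa / 4 by rewrite divr_gt0.
(* The constant of [projected_step] at [e = kappa / 4]. *)
pose K := 2 + (kappa / 4)^-1.
have K0 : 0 <= K by rewrite addr_ge0 // invr_ge0 ltW.
exists (K * (c + 2 * c2)) => [|k r s Er Es].
  by rewrite mulr_ge0 // addr_ge0 // mulr_ge0.
have Kg0 : 0 <= K * gamma k ^+ 2 by rewrite mulr_ge0 ?sqr_ge0.
pose Q a := 1 * (c * (1 + D k a + Dp k a)) + 2 * sqn (w k a).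
have mS : measurable_fun setT (fun a => c * (1 + D k a + Dp k a)).
  by apply: measurable_funM => //; apply: measurable_funD => //; exact: measurable_funD.
have S0 a : 0 <= c * (1 + D k a + Dp k a) by rewrite mulr_ge0 // !addr_ge0.
have mQ : measurable_fun setT Q.
  by apply: measurable_funD; apply: measurable_funM.
have Q0 a : 0 <= Q a by rewrite /Q addr_ge0 // mulr_ge0 // sqn_ge0.
have H0 a : 0 <= H k a by exact: sqdist_ge0.
have step a : 1 * D k.+1 a + 2^-1 * H k a <=
    (1 + kappa / 4) * D k a + K * gamma k ^+ 2 * Q a.
  have XA : X `<=` Xs (l k a) by move=> v; exact.
  have := @projected_step R n X _ projX _ (x k a) (Fo (y k a) (omega k a)) (gamma k) _
    XA (@Xs_convex (l k a)) projXP (@projP (l k a)) k40.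
  rewrite -x_step -/(D k.+1 a) -/(H k a) -/(D k a) mul1r (mulrC 2^-1).
  move=> /le_trans; apply; rewrite lerD2l ler_wpM2l // /Q mul1r.
  by have [_] := growth (x k a) (xp k a) (Fo (y k a) (omega k a)).
have : (\int[P]_a (1 * D k.+1 a + 2^-1 * H k a)%:E <=
        \int[P]_a ((1 + kappa / 4) * D k a + K * gamma k ^+ 2 * Q a)%:E)%E.
  apply: expect_le => // [a||].
  - by rewrite addr_ge0 ?mulr_ge0 // invr_ge0.
  - by apply: measurable_funD; apply: measurable_funM.
  - by apply: measurable_funD; apply: measurable_funM.
have i2 : 0 <= 2^-1 :> R by rewrite invr_ge0.
have kp : 0 <= 1 + kappa / 4 by rewrite addr_ge0 // ltW.
have w0 a : 0 <= sqn (w k a) by exact: sqn_ge0.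
rewrite !expect_lin //.
rewrite (expect_affine c0 _ _ _ _ Er Es) // Er mul1e.
have gain := expected_projection_gain k; rewrite Er in gain.
have {}noise_le := noise_le k r s Er Es.
move=> main.
have : (\int[P]_a (D k.+1 a)%:E + (2^-1 * (kappa * r))%:E <=
   ((1 + kappa / 4) * r + K * gamma k ^+ 2 * (c * (1 + r + s) + 2 * (c2 * (1 + r + s))))%:E)%E.
  apply: le_trans (le_trans main _).
    by rewrite leeD2l // EFinM lee_wpmul2l // lee_fin.
  rewrite -EFinM [leRHS]EFinD leeD2l // [leRHS]EFinM lee_wpmul2l ?lee_fin //.
  by rewrite ?mul1e [leRHS]EFinD leeD2l // [leRHS]EFinM lee_wpmul2l ?lee_fin.
(* Half the expected gain, [kappa / 2 * r], moves to the right: [1 + kappa / 4 - kappa / 2 = 1 -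
   kappa / 4]. *)
rewrite -leeBrDr // -EFinB => /le_trans; apply; rewrite lee_fin le_eqVlt.
by apply/orP; left; apply/eqP; field.
Qed.

Lemma expected_sqdist_recursion : exists A (e e' : nat -> R),
  [/\ 0 <= A, (forall k, (\int[P]_a (sqdist projX (x k a))%:E = (e k)%:E)%E),
      (forall k, 0 <= e' k), (forall k, e' k.+1 = e k) &
      forall k, e k.+1 <=
        (1 - kappa / 4) * e k + gamma k ^+ 2 * (A + A * e k + A * e' k)].
Proof.
have [A A0 step] := expected_sqdist_step.
have E0 k : (0 <= \int[P]_a (D k a)%:E)%E by apply: integral_ge0 => a _; rewrite lee_fin.
have Ep0 k : (0 <= \int[P]_a (Dp k a)%:E)%E by apply: integral_ge0 => a _; rewrite lee_fin.
pose e k := fine (\int[P]_a (D k a)%:E); pose e' k := fine (\int[P]_a (Dp k a)%:E).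
(* Finiteness propagates by induction: the two initial points are deterministic, and the step bounds
   each new expectation by a real number. *)
have fin k : (\int[P]_a (D k a)%:E = (e k)%:E)%E /\ (\int[P]_a (Dp k a)%:E = (e' k)%:E)%E.
  elim: k => [|k [IH IH']].
    rewrite /e /e'; under eq_integral do rewrite /D x_init.
    by rewrite /Dp /= !expect_cst.
  split; last exact: IH.
  rewrite fineK // ge0_fin_numE //.
  by apply: le_lt_trans (step k _ _ IH IH') _; rewrite ltry.
exists A, e, e'; split => // [k|k|k].
- exact: (fin k).1.
- by rewrite fine_ge0.
- have [h h'] := fin k; have := step k _ _ h h'.
  by rewrite (fin k.+1).1 lee_fin.
Qed.

End process.

(** * Rates *)

Section polynomial_rates.
Variable R : realType.

Lemma bernoulli_le (a : R) k : 0 <= a <= 1 -> 1 - k%:R * a <= (1 - a) ^+ k.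
Proof.
move=> /andP[a0 a1]; elim: k => [|k IH]; first by rewrite mul0r subr0 expr0.
rewrite exprS -natr1.
have : (1 - a) * (1 - k%:R * a) <= (1 - a) * (1 - a) ^+ k.
  by rewrite ler_wpM2l // subr_ge0.
have : 0 <= k%:R * a * a by rewrite !mulr_ge0.
lra.
Qed.

Lemma powR_slow_decay (t b : R) : 0 < b -> exists N, forall k, (N <= k)%N ->
  (1 - b) * (k%:R `^ t)^-1 <= (k.+1%:R `^ t)^-1.
Proof.
move=> b0; pose M := (Num.truncn t).+1; pose N := (Num.truncn (M%:R / b)).+1.
exists N.+1 => k Nk.
have k0 : 0 < k%:R :> R by rewrite ltr0n (leq_trans _ Nk).
have k10 : 0 < k.+1%:R :> R by rewrite ltr0n.
have kt0 : 0 < k%:R `^ t by exact: powR_gt0.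
have k1t0 : 0 < k.+1%:R `^ t by exact: powR_gt0.
have tM : t <= M%:R by apply/ltW; exact: truncnS_gt.
rewrite ler_pdivrMr // mulrC ler_pdivlMr //.
pose a : R := k.+1%:R^-1.
have a01 : 0 <= a <= 1 by rewrite invr_ge0 ler0n /= invf_le1 // ler1n.
have -> : k%:R = (1 - a) * k.+1%:R :> R.
  by rewrite /a mulrBl mul1r mulVf ?gt_eqF // -natr1 addrK.
have a1 : 0 < 1 - a by rewrite subr_gt0 invf_lt1 // ltr1n ltnS (leq_trans _ Nk).
rewrite powRM ?(ltW a1) ?ler0n // ler_wpM2r ?(ltW k1t0) //.
apply: (@le_trans _ _ ((1 - a) `^ M%:R)); last first.
  by apply: ger_powR => //; rewrite a1 gerBl; case/andP: a01.
rewrite powR_mulrn ?(ltW a1) //; apply: le_trans (bernoulli_le M a01).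
rewrite lerD2l lerN2 /a ler_pdivrMr //.
have : M%:R / b < N%:R.
  exact: truncnS_gt.
rewrite ltr_pdivrMr // mulrC => /ltW /le_trans; apply.
by rewrite ler_wpM2l ?(ltW b0) // ler_nat ltnW // ltnW.
Qed.

Lemma cvg_invr_powR (t : R) : 1 <= t -> (k%:R `^ t)^-1 @[k --> \oo] --> (0 : R).
Proof.
move=> t1; apply/cvgrPdist_le => e e0.
exists (Num.truncn e^-1).+1 => // k /= Nk.
have k1 : 1 <= k%:R :> R by rewrite ler1n (leq_trans _ Nk).
have k0 : 0 < k%:R :> R by apply: lt_le_trans k1.
rewrite sub0r normrN ger0_norm ?invr_ge0 ?powR_ge0 //.
apply: (@le_trans _ _ k%:R^-1).
  by rewrite lef_pV2 ?posrE ?powR_gt0 // -[leLHS]powRr1 ?ler0n // ler_powR.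
rewrite -[leRHS]invrK lef_pV2 ?posrE ?invr_gt0 //.
by apply/ltW/(lt_le_trans (truncnS_gt _)); rewrite ler_nat.
Qed.

Lemma sqr_inv_powR (t : R) k : ((k%:R `^ (t / 2))^-1) ^+ 2 = (k%:R `^ t)^-1 :> R.
Proof.
rewrite exprVn; congr (_^-1).
by rewrite -powR_mulrn ?powR_ge0 // -powRrM divfK.
Qed.

(** Here [q] lies strictly between 0 and 1, so the inverse of [1 - q] exceeds 1. Positivity keeps
    index 0, where the stepsize formula is not assumed, out of the rates. *)
Lemma kbar_gt0 (b t : R) : 0 < b < 2 -> 0 < t -> (0 < kbar b t)%N.
Proof.
move=> /andP[b0 b2] t0; rewrite /kbar absz_gt0 gt_eqF // ceil_gt0 subr_gt0.
set q := _ `^ _.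
have q0 : 0 < q by apply: powR_gt0; lra.
have q1 : q < 1.
  have := @gt0_ltr_powR R t^-1 _ (1 - b / 2) 1.
  by rewrite powR1; apply; rewrite ?nnegrE ?invr_gt0 //; lra.
by rewrite invf_gt1 ?subr_gt0 // gtrBl.
Qed.

End polynomial_rates.

(** * From expected squared distances to almost sure and mean convergence *)

Section almost_sure_and_mean.
Context d (T : measurableType d) (R : realType) (P : probability T R).

(* The expectation of the series of the [f k] is finite, so it converges almost
   surely. *)
Lemma ae_cvg0_of_summable_mean (f : nat -> T -> R) (e : nat -> R) (c : R) :
  (forall k a, 0 <= f k a) -> (forall k, measurable_fun setT (f k)) ->
  (forall k, (\int[P]_a (f k a)%:E = (e k)%:E)%E) ->
  (forall K, \sum_(0 <= k < K) e k <= c) ->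
  {ae P, forall a, f k a @[k --> \oo] --> 0}.
Proof.
move=> f0 mf Ef ec.
pose S a := (\sum_(0 <= k <oo) (f k a)%:E)%E.
have S0 a : (0 <= S a)%E by apply: nneseries_ge0 => k _ _; rewrite lee_fin.
have mS : measurable_fun setT S.
  by apply: ge0_emeasurable_sum => // [k a _|k] _; [rewrite lee_fin | exact/measurable_EFinP].
have : P.-integrable setT S.
  apply/integrableP; split => //.
  under eq_integral do rewrite gee0_abs //.
  rewrite integral_nneseries //; last 2 first.
  - by move=> k; exact/measurable_EFinP.
  - by move=> k a _; rewrite lee_fin.
  under eq_eseriesr do rewrite Ef.
  apply: (@le_lt_trans _ _ c%:E); last by rewrite ltry.
  apply: lime_le.
    apply: is_cvg_nneseries => k _ _; rewrite -Ef.
    by apply: integral_ge0 => a _; rewrite lee_fin.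
  by apply: nearW => K; rewrite sumEFin lee_fin.
move=> /(integrable_ae measurableT); apply: filterS => a /(_ I) Sfin.
apply: cvg_series_cvg_0; apply: nnseries_is_cvg => //.
by rewrite ltey_eq Sfin.
Qed.

(** Pointwise, twice the distance is at most its square over [s] plus [s]. The free scale [s] is
    later matched to the size of the distance. *)
Lemma expect_dist_le n (v : T -> 'rV[R]_n) (X : set 'rV[R]_n) pr r s :
  (forall z, is_proj X z (pr z)) ->
  (forall j, measurable_fun setT (fun a => v a 0 j)) -> 0 < s ->
  (\int[P]_a (sqdist pr (v a))%:E <= r%:E)%E ->
  (\int[P]_a (dist (v a) X)%:E <= ((r / s + s) / 2)%:E)%E.
Proof.
move=> prP mv s0 Er.
have mq : measurable_fun setT (fun a => sqdist pr (v a)) := measurable_sqdist prP mv.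
have distE a : dist (v a) X = Num.sqrt (sqdist pr (v a)) by rewrite (dist_proj (prP (v a))).
have c0 : 0 <= (2 * s)^-1 by rewrite invr_ge0 mulr_ge0 // ltW.
apply: (@le_trans _ _ (\int[P]_a ((2 * s)^-1 * sqdist pr (v a) + 1 * (s / 2))%:E)%E).
  apply: expect_le => [a|||a].
  - by rewrite distE sqrtr_ge0.
  - under eq_fun do rewrite distE.
    have msqrt : measurable_fun setT (Num.sqrt : R -> R).
      by apply: continuous_measurable_fun; exact: sqrt_continuous.
    exact: measurableT_comp msqrt mq.
  - by apply: measurable_funD => //; exact: measurable_funM.
  - rewrite distE mul1r; have := sqr_sqrtr (sqdist_ge0 pr (v a)).
    move: (Num.sqrt _) => b <-; rewrite -subr_ge0.
    have -> : (2 * s)^-1 * b ^+ 2 + s / 2 - b = (2 * s)^-1 * (b - s) ^+ 2.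
      by field; rewrite gt_eqF.
    by rewrite mulr_ge0 ?sqr_ge0.
have s20 : 0 <= s / 2 by rewrite divr_ge0 // ltW.
rewrite expect_lin // => [|a]; last exact: sqdist_ge0.
rewrite expect_cst mul1e.
have -> : (r / s + s) / 2 = (2 * s)^-1 * r + s / 2 by field; rewrite gt_eqF.
by rewrite EFinD leeD2r // EFinM lee_wpmul2l.
Qed.

End almost_sure_and_mean.

(** * Asymptotic feasibility of the iterates and of their averages *)

Theorem theorem4
  (R : realType) (n m : nat) (hm : (0 < m)%N)
  (Xs : 'I_m -> set 'rV[R]_n)
  (proj : 'I_m -> 'rV[R]_n -> 'rV[R]_n) (projX : 'rV[R]_n -> 'rV[R]_n)
  (DX : R) (F : 'rV[R]_n -> 'rV[R]_n) (L C eta : R) (rho : 'I_m -> R)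
  (d : measure_display) (Omega : measurableType d) (P : probability Omega R)
  (d' : measure_display) (Xi : measurableType d')
  (omega : nat -> Omega -> Xi) (l : nat -> Omega -> 'I_m)
  (Fo : 'rV[R]_n -> Xi -> 'rV[R]_n) (nu1 nu2 : R)
  (gamma : nat -> R) (xm1 x0 : 'rV[R]_n) (x : nat -> Omega -> 'rV[R]_n) :
  let X := [set v | forall i, Xs i v] in
  let Fk := hist_filtration l omega in
  let y := fun k a => 2 *: x k a - xprev xm1 x k a in
  let w := fun k a => Fo (y k a) (omega k a) - F (y k a) in
  let rho_min := \big[Num.min/1]_(i < m) rho i in
  let beta := 1 - rho_min / (32 * m%:R * eta) in
  (* the sets X_i : closed, convex; X nonempty and bounded *)
  (forall i, closed (Xs i)) ->
  (forall i, convex_set (Xs i)) ->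
  (exists v, X v) ->
  (forall i v, is_proj (Xs i) v (proj i v)) ->
  (forall v, is_proj X v (projX v)) ->
  0 < DX -> (forall u v, X u -> X v -> enorm (u - v) ^+ 2 <= DX ^+ 2) ->
  (* (A1) *)
  0 < L -> (forall u v, enorm (F u - F v) <= L * enorm (u - v)) ->
  (forall u v, 0 <= dotv (F u - F v) (u - v)) ->
  (* (A2) *)
  (exists xs, VIsol X F xs) -> compact (VIsol X F) ->
  (forall xs, VIsol X F xs -> enorm (F xs) <= C) ->
  (* random indices and noise are random variables *)
  (forall j i, measurable (l j @^-1` [set i])) ->
  (forall j, measurable_fun setT (omega j)) ->
  (* the iterates are adapted to the history filtration *)
  (forall k j, Gmeas (Fk k) (fun a => x k a 0 j)) ->
  (* (r-SPRG) *)
  (forall k, 0 < gamma k) ->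
  (forall a, x 0%N a = x0) ->
  (forall k a, x k.+1 a = proj (l k a) (x k a - gamma k *: Fo (y k a) (omega k a))) ->
  (* (A4) *)
  0 <= nu1 -> 0 <= nu2 ->
  (forall k j, exists Z, cond_exp P (Fk k) (fun a => w k a 0 j) Z /\
                         {ae P, forall a, Z a = 0}) ->
  (forall k, exists Z, cond_exp_nneg P (Fk k) (fun a => enorm (w k a) ^+ 2) Z /\
                       {ae P, forall a, (Z a <= (nu1 ^+ 2 * enorm (y k a) ^+ 2 + nu2 ^+ 2)%:E)%E}) ->
  (* (A5) *)
  0 < eta ->
  (forall v, enorm (v - projX v) ^+ 2 <=
             eta * \big[Num.max/0]_(i < m) (enorm (v - proj i v) ^+ 2)) ->
  (* (A6) *)
  (forall i, 0 < rho i <= 1) ->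
  (forall i k, exists Z, cond_exp P (Fk k) (fun a => (l k a == i)%:R) Z /\
                         {ae P, forall a, rho i / m%:R <= Z a}) ->
  (* conclusions *)
  [/\ (* (a) *)
      (series gamma @ \oo --> +oo) -> cvgn (series (fun k => gamma k ^+ 2)) ->
      {ae P, forall a, dist (x k a) X @[k --> \oo] --> 0},
      (* (b) *)
      (forall t : R, 1 <= t ->
         (forall k, (0 < k)%N -> gamma k = (k%:R `^ (t / 2))^-1) ->
         exists c : R, forall k, (kbar beta t <= k)%N ->
           (\int[P]_a (dist (x k a) X)%:E <= (c / k%:R `^ (t / 2))%:E)%E) &
      (* (c) *)
      ((forall k, (0 < k)%N -> gamma k = (k%:R `^ (1 / 2))^-1) ->
         let kb := kbar beta 1 in
         let xbar := fun K a =>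
           (\sum_(kb + K./2 <= k < (kb + K).+1) gamma k)^-1 *:
             \sum_(kb + K./2 <= k < (kb + K).+1) (gamma k *: x k a) in
         exists c : R, forall K, (0 < K)%N ->
           (\int[P]_a (dist (xbar K a) X)%:E <= (c / Num.sqrt K%:R)%:E)%E)].
Proof.
move=> X Fk y w rho_min beta _ cvxX neX projP projXP _ bndX L0 lipF _ _ _ _.
move=> l_meas o_meas adapt gamma0 init step _ _ _ noise eta0 reg rho01 sampl.
have distE v : dist v X = Num.sqrt (sqdist projX v) by rewrite (dist_proj (projXP v)).
have X_convex : convex_set X.
  move=> p q a pX qX; rewrite !inE in pX qX *; move=> i.
  by have := cvxX i p q a; rewrite !inE; apply.
have x_meas := iterate_measurable l_meas o_meas adapt.
(* In dimension 0 every distance vanishes; this case is set apart because [eta_ge1] relies on a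
   point outside [X]. *)
have [n0|npos] := posnP n.
  have dist0 v : dist v X = 0.
    rewrite distE /sqdist /sqn big1 ?sqrtr0 // => j _.
    by have := ltn_ord j; rewrite [X in (_ < X)%N]n0.
  split => [_ _|t _ _|_ kb xbar].
  - by apply: nearW => a; under eq_fun do rewrite dist0; exact: cvg_cst.
  - by exists 0 => k _; under eq_integral do rewrite dist0; rewrite integral0 mul0r.
  - by exists 0 => k _; under eq_integral do rewrite dist0; rewrite integral0 mul0r.
have eta1 := eta_ge1 neX projP projXP bndX eta0 reg npos.
have rm0 : 0 < rho_min := rho_min_gt0 rho01.
have rm1 : rho_min <= 1 := rho_min_le1 hm rho01.
have m1 : 1 <= m%:R :> R by rewrite ler1n.
have me1 : 1 <= m%:R * eta by rewrite mulr_ege1.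
pose kappa := rho_min / (m%:R * eta).
have kappa0 : 0 < kappa by rewrite divr_gt0 // (lt_le_trans _ me1).
have kappa1 : kappa <= 1.
  by rewrite ler_pdivrMr ?(lt_le_trans _ me1) // mul1r (le_trans rm1).
have beta02 : 0 < beta < 2.
  have -> : beta = 1 - kappa / 32.
    rewrite /beta /kappa; field; apply/andP; split; rewrite gt_eqF //.
    exact: lt_le_trans m1.
  by apply/andP; split; lra.
have [A [e [e' [A0 Ee e'0 e'S rec]]]] := expected_sqdist_recursion hm cvxX neX
  projP projXP bndX L0 lipF l_meas o_meas adapt init step noise eta0 reg rho01 sampl.
rewrite -/kappa in rec.
have e0 k : 0 <= e k.
  by rewrite -lee_fin -Ee; apply: integral_ge0 => a _; rewrite lee_fin sqdist_ge0.
have D_meas k : measurable_fun setT (fun a => sqdist projX (x k a)).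
  exact: measurable_sqdist projXP (x_meas k).
(* The potential of [delayed_contraction] with [a = kappa / 4]; it dominates [e]. *)
pose V k := e k + kappa / 4 / 4 * e' k.
have kappa16 : 0 <= kappa / 4 / 4 by lra.
have V0 k : 0 <= V k by rewrite addr_ge0 // mulr_ge0.
have eV k : e k <= V k by rewrite lerDl mulr_ge0.
have kappa41 : 0 < kappa / 4 <= 1 by apply/andP; split; lra.
have kappa80 : 0 < kappa / 4 / 2 by lra.
have potential : (fun k => gamma k ^+ 2) @ \oo --> 0 ->
    exists N, forall k, (N <= k)%N ->
      V k.+1 <= (1 - kappa / 4 / 2) * V k + A * gamma k ^+ 2.
  move=> g0; apply: (delayed_contraction kappa41 A0 e0 e'0 e'S _ g0 rec).
  by move=> k; exact: sqr_ge0.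
have rate t : 1 <= t ->
    (forall k, (0 < k)%N -> gamma k = (k%:R `^ (t / 2))^-1) ->
    exists2 c, 0 <= c & forall k, e k <= c * gamma k ^+ 2.
  move=> t1 gE.
  have gE2 k : (0 < k)%N -> gamma k ^+ 2 = (k%:R `^ t)^-1.
    by move=> k0; rewrite gE // sqr_inv_powR.
  have [|N1 NP] := potential.
    apply: cvg_trans (cvg_invr_powR t1); apply: near_eq_cvg.
    by exists 1%N => // k /= k0; rewrite gE2.
  have b0 : 0 < kappa / 4 / 2 / 2 by lra.
  have [N2 slow] := @powR_slow_decay R t _ b0.
  (* The successor in [N2.+1] makes every index considered positive, so the stepsize formula
     applies. *)
  have [||||c c0 Vc] := @contraction_rate R V (fun k => gamma k ^+ 2)
      (kappa / 4 / 2) A (maxn N1 N2.+1) kappa80 A0 V0 _ _ _ _.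
  - by move=> k; rewrite exprn_gt0.
  - move=> k; rewrite geq_max => /andP[_ N2k]; rewrite !gE2 ?(leq_trans _ N2k) //.
    by apply: slow; exact: ltnW.
  - by move=> k; rewrite geq_max => /andP[N1k _]; exact: NP.
  - lra.
  by exists c => // k; apply: le_trans (eV k) (Vc k).
split => [_ sg|t t1 gE|gE kb xbar].
- have [N NP] := potential (cvg_series_cvg_0 sg).
  have [c ec] := contraction_summable kappa80 A0 V0 (fun k => sqr_ge0 _) sg NP.
  have : {ae P, forall a, sqdist projX (x k a) @[k --> \oo] --> 0}.
    apply: (ae_cvg0_of_summable_mean (e := e) (c := c)) => // [k a|K].
      exact: sqdist_ge0.
    by apply: le_trans (ec K); apply: ler_sum => k _; exact: eV.
  apply: filterS => a Da; under eq_fun do rewrite distE.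
  by rewrite -(sqrtr0 R); apply: continuous_cvg => //; exact: sqrt_continuous.
- have [c c0 ec] := rate t t1 gE.
  (* With scale [s = gamma k] and mean square at most [c * gamma k ^+ 2], both halves of the bound
     are multiples of [gamma k]. *)
  exists ((c + 1) / 2) => k kk.
  have k0 : (0 < k)%N by apply: leq_trans kk; apply: kbar_gt0 => //; lra.
  have gk := gamma0 k.
  have : (\int[P]_a (sqdist projX (x k a))%:E <= (c * gamma k ^+ 2)%:E)%E.
    by rewrite Ee lee_fin.
  move=> /(expect_dist_le projXP (x_meas k) gk) /le_trans; apply.
  rewrite lee_fin -gE // le_eqVlt; apply/orP; left; apply/eqP.
  by field; rewrite gt_eqF.
- have [c c0 ec] := rate 1 (lexx _) gE.
  (* From the scale [(Num.sqrt K%:R)^-1] and the mean-square bound [2 * c / K%:R]. *)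
  exists ((2 * c + 1) / 2) => K K0.
  have kb0 : (0 < kb)%N by exact: kbar_gt0.
  pose s := index_iota (kb + K./2) (kb + K).+1.
  have sN : s != [::].
    rewrite -size_eq0 size_iota -lt0n subn_gt0 ltnS leq_add2l.
    by rewrite -{2}(odd_double_half K) -addnn addnA leq_addl.
  have W0 : 0 < \sum_(k <- s) gamma k.
    case: s sN => // k s' _; rewrite big_cons ltr_wpDr //.
    by apply: sumr_ge0 => j _; exact: ltW.
  have K0' : 0 < K%:R :> R by rewrite ltr0n.
  (* Averaging starts at [kb + K./2] with [kb] positive, so [k >= K./2 + 1]; hence [K <= 2 * k] also
     for odd [K], and [gamma k ^+ 2] is the inverse of [k]. *)
  have sK k : k \in s -> gamma k ^+ 2 <= 2 / K%:R.
    rewrite mem_index_iota => /andP[kk _].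
    have k0 : (0 < k)%N by apply: leq_trans kk; rewrite addn_gt0 kb0.
    rewrite gE // sqr_inv_powR powRr1 ?ler0n // -[leLHS]div1r.
    rewrite ler_pdivrMr ?ltr0n // mulrAC ler_pdivlMr // mul1r -natrM ler_nat.
    have : (K <= K./2 * 2 + 1)%N.
      by rewrite muln2 -{1}(odd_double_half K) addnC leq_add2l; case: odd.
    move=> /leq_trans; apply; rewrite (mulnC 2%N).
    have k2 : (K./2.+1 <= k)%N by rewrite (leq_trans _ kk) // -add1n leq_add2r.
    by rewrite (leq_trans _ (leq_mul k2 (leqnn 2))) // mulSn addnC leq_add2r.
  have xbarE a : xbar K a =
      (\sum_(k <- s) gamma k)^-1 *: \sum_(k <- s) gamma k *: x k a by [].
  have xbar_meas j : measurable_fun setT (fun a => xbar K a 0 j).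
    under eq_fun do rewrite xbarE mxE summxE.
    apply: measurable_funM => //; apply: measurable_sum => k.
    by under eq_fun do rewrite mxE; exact: measurable_funM.
  have Exbar : (\int[P]_a (sqdist projX (xbar K a))%:E <= (c * (2 / K%:R))%:E)%E.
    (* Jensen is applied for each outcome; the weights are deterministic, so the expectation then
       passes to each [sqdist projX (x k a)]. *)
    apply: (@le_trans _ _ (\int[P]_a ((\sum_(k <- s) gamma k)^-1 *
        \sum_(k <- s) gamma k * sqdist projX (x k a))%:E)%E).
      apply: expect_le => [a|||a].
      - exact: sqdist_ge0.
      - exact: measurable_sqdist projXP xbar_meas.
      - by apply: measurable_funM => //; apply: measurable_sum => k; exact: measurable_funM.
      - rewrite xbarE; apply: (@convex_average R n (sqdist projX) gamma (x^~ a)) => // b u v.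
        exact: (sqdist_convex u v X_convex projXP).
    under eq_integral do rewrite EFinM -sumEFin.
    rewrite ge0_integralZl_EFin //; last 3 first.
    - by move=> a _; apply: sume_ge0 => k _; rewrite lee_fin mulr_ge0 ?sqdist_ge0 // ltW.
    - by apply: emeasurable_sum => k; apply/measurable_EFinP; exact: measurable_funM.
    - by rewrite invr_ge0 ltW.
    rewrite ge0_integral_sum //; last 2 first.
    - by move=> k; apply/measurable_EFinP; exact: measurable_funM.
    - by move=> k a _; rewrite lee_fin mulr_ge0 ?sqdist_ge0 // ltW.
    rewrite (eq_bigr (fun k => (gamma k * e k)%:E)) => [|k _]; last first.
      under eq_integral do rewrite EFinM.
      rewrite ge0_integralZl_EFin ?Ee //.
      - by move=> a _; rewrite lee_fin sqdist_ge0.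
      - exact/measurable_EFinP.
      - exact: ltW.
    rewrite sumEFin -EFinM lee_fin ler_pdivrMl // mulr_suml.
    rewrite big_seq [leRHS]big_seq; apply: ler_sum => k /sK gk.
    by rewrite ler_wpM2l ?(ltW (gamma0 k)) // (le_trans (ec k)) // ler_wpM2l.
  have sqK : 0 < (Num.sqrt K%:R)^-1 :> R by rewrite invr_gt0 sqrtr_gt0.
  apply: le_trans (expect_dist_le projXP xbar_meas sqK Exbar) _.
  rewrite lee_fin le_eqVlt; apply/orP; left; apply/eqP.
  have := sqr_sqrtr (ltW K0'); have : Num.sqrt (K%:R : R) != 0 by rewrite gt_eqF // sqrtr_gt0.
  move: (Num.sqrt _) => q q0 <-; field; exact: q0.
Qed.
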